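(* Let $X$ be a set, $F$ a field, $d\in\mathbb{N}$ with $d\ge 2$, and $\overline{f}:X\to F^d$. If $\overline{f}(X)$ is not contained in a finite union of proper subspaces of $F^d$, then $\mathcal{C}_{\overline{f}}$ is maximal of Littlestone dimension $d-1$. In particular, $\operatorname{Lden}(\mathcal{C}_{\overline{f}})=d-1$.
   Context: Notation: $\mathbb{N}$ includes $0$; $[n]=\{k\in\mathbb{N}: 0\le k<n\}$; ${}^{A}B$ is the set of functions from $A$ to $B$; $\mathcal{P}(X)$ is the power set of $X$; $\binom{n}{\le m}=\sum_{i=0}^{m}\binom{n}{i}$. Zero sets: for $\overline{a},\overline{b}\in F^d$, $\overline{a}\cdot\overline{b}=\sum_{i=0}^{d-1}a_ib_i$. For $\overline{f}:X\to F^d$ and $\overline{a}\in F^d$, let $Z_{\overline{f},\overline{a}}=\{c\in X:\overline{a}\cdot\overline{f}(c)=0\}$ and $\mathcal{C}_{\overline{f}}=\{Z_{\overline{f},\overline{a}}:\overline{a}\in F^d\setminus\{\overline{0}\}\}\subseteq\mathcal{P}(X)$. Trees: let $\mathcal{C}\subseteq\mathcal{P}(X)$ and $n\in\mathbb{N}$. An $(X,\mathcal{C})$-labeled tree of depth $n$ is a function $T:\bigcup_{k\le n}{}^{[k]}[2]\to X\cup\mathcal{C}$ such that $T(\sigma)\in X$ for all $\sigma\in{}^{[k]}[2]$ with $0\le k<n$, and $T(\tau)\in\mathcal{C}$ for all $\tau\in{}^{[n]}[2]$. For $\tau\in{}^{[n]}[2]$, the leaf $(\tau,T(\tau))$ is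 well-labeled if for all $0\le k<n$: $T(\tau|_{[k]})\in T(\tau)\iff\tau(k)=1$. Littlestone shatter function and density: $\rho_{\mathcal{C}}(n)$ is the maximum number of well-labeled leaves of an $(X,\mathcal{C})$-labeled tree of depth $n$. $\operatorname{Lden}(\mathcal{C})$ is the infimum over all positive $\ell\in\mathbb{R}$ such that there exists $K\in\mathbb{R}$ with $\rho_{\mathcal{C}}(n)\le Kn^{\ell}$ for all $n\ge 1$. Maximality: for $m\in\mathbb{N}$, $\mathcal{C}$ is maximal of Littlestone dimension $m$ if $\rho_{\mathcal{C}}(n)=\binom{n}{\le m}$ for all $n\ge m$. *)

(* Defs.v *)
From mathcomp Require Import all_boot all_order all_algebra.
From mathcomp Require Import boolp classical_sets reals constructive_ereal ereal exp.

Set Implicit Arguments.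
Unset Strict Implicit.
Unset Printing Implicit Defensive.

Import Order.TTheory GRing.Theory Num.Theory.

Local Open Scope classical_set_scope.
Local Open Scope ring_scope.

Definition binom_le (n m : nat) : nat := (\sum_(i < m.+1) 'C(n, i))%N.

Section ZeroSets.
Variables (X : Type) (F : fieldType) (d : nat).

Definition dotp (a b : 'rV[F]_d) : F := \sum_(i < d) a 0 i * b 0 i.

Definition zero_set (f : X -> 'rV[F]_d) (a : 'rV[F]_d) : set X :=
  [set c | dotp a (f c) = 0].

Definition zero_sets (f : X -> 'rV[F]_d) : set (set X) :=
  [set Z | exists2 a : 'rV[F]_d, a != 0 & Z = zero_set f a].

End ZeroSets.

(* [bool] plays the role of [2] = {0, 1}, with true for 1. A labeling of all  *)
(* the nodes with values in X \cup C is split into its restriction to the     *)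
(* nodes at levels k < n and its restriction to level n.                      *)
Record ltree (X : Type) (C : set (set X)) (n : nat) := LTree {
  node : forall k : 'I_n, {ffun 'I_k -> bool} -> X;
  leaf : {ffun 'I_n -> bool} -> set X;
  leaf_in : forall t, C (leaf t)
}.

Definition restr (n : nat) (t : {ffun 'I_n -> bool}) (k : 'I_n) :
    {ffun 'I_k -> bool} :=
  [ffun i : 'I_k => t (widen_ord (ltnW (ltn_ord k)) i)].

Section Shatter.
Variables (X : Type) (C : set (set X)).

Definition well_labeled (n : nat) (T : ltree C n) (t : {ffun 'I_n -> bool}) :
    Prop :=
  forall k : 'I_n, leaf T t (node T (restr t k)) <-> t k = true.

Definition num_well_labeled (n : nat) (T : ltree C n) : nat :=
  #|[pred t : {ffun 'I_n -> bool} | `[< well_labeled T t >]]|.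

(* A tree of depth n has 2 ^ n leaves, so the bound on k loses nothing. The   *)
(* value is 0 when there is no tree of depth n.                               *)
Definition rho (n : nat) : nat :=
  (\max_(k < (2 ^ n).+1 |
     `[< exists T : ltree C n, num_well_labeled T = k >]) k)%N.

Definition maximal_Ldim (m : nat) : Prop :=
  forall n : nat, (m <= n)%N -> rho n = binom_le n m.

(* The infimum is taken in the extended reals: it is +oo for the empty set.   *)
Definition Lden (R : realType) : \bar R :=
  ereal_inf [set l%:E | l in [set l : R | 0 < l /\
    exists K : R, forall n : nat, (1 <= n)%N ->
      (rho n)%:R <= K * n%:R `^ l]].

End Shatter.

(* Main.v *)
(* For a linear subspace V of F^d of dimension m, consider the trees whose    *)
(* leaves are labeled by zero sets of nonzero vectors a in V. If x labels the *)
(* root, the labels of the well-labeled leaves on the 1-side lie in V :&:     *)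
(* f(x)^\perp, which is V (and then no leaf of the 0-side is well-labeled) or *)
(* has dimension m - 1, so Pascal's rule bounds their number by the sum of    *)
(* the 'C(n, i) for i < m. Conversely, by induction on n, this bound is       *)
(* attained, even if the vectors a are required not to be orthogonal to given *)
(* vectors b_1, ..., b_k outside V^\perp: the root x is chosen with f(x)      *)
(* outside finitely many proper subspaces, so that the b_j remain outside     *)
(* (V :&: f(x)^\perp)^\perp on the 1-side, and f(x) is added to the list of   *)
(* the b_j on the 0-side. The depth 0 case needs F to be infinite, which      *)
(* also follows from the hypothesis on f, as d >= 2.                          *)

Require Import Defs.
From mathcomp Require Import all_boot all_order all_algebra.
From mathcomp Require Import boolp classical_sets reals constructive_ereal ereal exp.
From mathcomp Require Import zify.

Set Implicit Arguments.
Unset Strict Implicit.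
Unset Printing Implicit Defensive.

Import Order.TTheory GRing.Theory Num.Theory.

Local Open Scope ring_scope.

(** Leaves on the 1-side of a node [x] have their normals in f(x)^\perp, which costs one dimension,
    while the 0-side costs none: this is Pascal's rule for [binom_lt], indexed by the dimension so
    that the zero space gets 0. [count_ok_upper] and [count_ok_lower] are inductions on the depth
    over a varying subspace [V], the row space of a matrix; [V *m b^T != 0] says that [b] is outside
    V^\perp. The lower bound rests on a generic choice of nodes, on [orth_in_swap] for the 1-side
    and on [exists_avoiding] for the leaves. With V = F^d they give [rho_zero_sets]. These values
    grow like n^(d-1), so [Lden_eq] gives the density. *)

Definition binom_lt (n m : nat) : nat := (\sum_(i < m) 'C(n, i))%N.

Lemma binom_ltS n m :
  binom_lt n.+1 m.+1 = (binom_lt n m.+1 + binom_lt n m)%N.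
Proof.
rewrite /binom_lt big_ord_recl [in RHS]big_ord_recl /= !bin0 -addnA.
congr addn; rewrite -big_split /=.
by apply: eq_bigr => i _; rewrite /bump /= add1n binS.
Qed.

Lemma binom_lt_monol n m : (binom_lt n m <= binom_lt n.+1 m)%N.
Proof.
apply: leq_sum => i _.
by case: (nat_of_ord i) => [|j]; rewrite ?bin0 // binS leq_addr.
Qed.

Lemma binom_lt_gt0 n m : (0 < m)%N -> (0 < binom_lt n m)%N.
Proof. by case: m => // m _; rewrite /binom_lt big_ord_recl bin0. Qed.

(** * Linear algebra of V :&: b^\perp *)

Section Dotp.
Variables (F : fieldType) (d : nat).
Implicit Types (a b : 'rV[F]_d) (V : 'M[F]_d).

Lemma mul_mx_trE a b : a *m b^T = (dotp a b)%:M.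
Proof.
apply/matrixP => i j; rewrite !ord1 !mxE eqxx mulr1n.
by apply: eq_bigr => k _; rewrite mxE.
Qed.

Lemma dotp_eq0 a b : (dotp a b == 0) = (a *m b^T == 0).
Proof.
rewrite mul_mx_trE; apply/eqP/eqP => [->|/matrixP/(_ 0 0)]; first exact: raddf0.
by rewrite !mxE eqxx mulr1n.
Qed.

Lemma dotpDl a a' b : dotp (a + a') b = dotp a b + dotp a' b.
Proof. by rewrite -big_split; apply: eq_bigr => i _; rewrite mxE mulrDl. Qed.

Lemma dotpZl c a b : dotp (c *: a) b = c * dotp a b.
Proof. by rewrite big_distrr /=; apply: eq_bigr => i _; rewrite mxE mulrA. Qed.

Definition orth_in V b : 'M[F]_d := (V :&: kermx b^T)%MS.

Lemma sub_orth_in V a b :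
  (a <= orth_in V b)%MS = (a <= V)%MS && (dotp a b == 0).
Proof. by rewrite sub_capmx sub_kermx dotp_eq0. Qed.

(** Rank-nullity for a |-> a.b on [V]: the image has dimension 0 or 1, which the boolean records. *)
Lemma rank_orth_in V b :
  \rank V = ((V *m b^T != 0)%R + \rank (orth_in V b))%N.
Proof.
rewrite -[LHS](mxrank_mul_ker V b^T); congr addn.
rewrite -mxrank_eq0; case: (\rank _) (rank_leq_col (V *m b^T)) => [|[]] //.
Qed.

Lemma sub_dotp_neq0 V a b : (a <= V)%MS -> dotp a b != 0 -> V *m b^T != 0.
Proof.
move=> /submxP[u ->]; rewrite dotp_eq0 -mulmxA; apply: contra_neq => ->.
by rewrite mulmx0.
Qed.

Lemma exists_dotp_neq0 V b :
  V *m b^T != 0 -> exists2 a, (a <= V)%MS & dotp a b != 0.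
Proof.
move=> /rowV0Pn[u /submxP[w ->] uVb]; exists (w *m V); first exact: submxMl.
by rewrite dotp_eq0 -mulmxA.
Qed.

(* V :&: b^\perp and V :&: y^\perp have the same dimension, so if one of them  *)
(* is contained in the other, then they are equal.                            *)
Lemma orth_in_swap V b y : V *m b^T != 0 -> V *m y^T != 0 ->
  orth_in V b *m y^T != 0 -> orth_in V y *m b^T != 0.
Proof.
move=> Vb Vy; apply: contra_neq => Wb.
have sWW : (orth_in V y <= orth_in V b)%MS.
  by rewrite sub_capmx sub_kermx capmxSl Wb eqxx.
have /mxrank_leqif_sup[_] := sWW.
have := rank_orth_in V b; rewrite (rank_orth_in V y) Vb Vy => /addnI->.
rewrite eqxx => /esym sWW'; apply/eqP; rewrite -sub_kermx.
exact: submx_trans sWW' (capmxSr _ _).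
Qed.

Hypothesis F_infinite : forall s : seq F, exists c, c \notin s.

Lemma exists_avoiding V (bs : seq 'rV[F]_d) :
    V != 0 -> (forall b, b \in bs -> V *m b^T != 0) ->
  exists a, [/\ a != 0, (a <= V)%MS & forall b, b \in bs -> dotp a b != 0].
Proof.
move=> V0; elim: bs => [_|b bs IH Vbs].
  by exists (nz_row V); rewrite nz_row_eq0 nz_row_sub.
have [|a [a0 aV abs]] := IH; first by move=> x xbs; rewrite Vbs // inE xbs orbT.
have [v vV vb] := exists_dotp_neq0 (Vbs b (mem_head _ _)).
(* On the line [a + c *: v], each x with v.x != 0 excludes a single c. If v.x = 0, then x is not b,
   and a.x != 0 is kept for every c. *)
have [c] := F_infinite [seq - dotp a x / dotp v x | x <- b :: bs].
have dotp0 x : x \in b :: bs -> dotp v x != 0 ->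
    c \notin [seq - dotp a x / dotp v x | x <- b :: bs] ->
    dotp (a + c *: v) x != 0.
  move=> xbs vx; apply: contra; rewrite dotpDl dotpZl => /eqP avx.
  apply/mapP; exists x => //; apply: (canRL (mulfK vx)).
  by apply/eqP; rewrite -addr_eq0 addrC avx.
move=> cs; have abs' x : x \in b :: bs -> dotp (a + c *: v) x != 0.
  move=> xbs; have [vx|/dotp0->//] := eqVneq (dotp v x) 0.
  rewrite dotpDl dotpZl vx mulr0 addr0 abs //.
  by move: xbs; rewrite inE => /predU1P[xb|//]; rewrite -xb vx eqxx in vb.
exists (a + c *: v); split => //; last by rewrite addmx_sub // scalemx_sub.
apply: contraNneq (abs' b (mem_head _ _)) => ->.
by rewrite dotp_eq0 mul0mx.
Qed.

End Dotp.

(** * Recursive count of well-labeled leaves *)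

Section Count.
Variables (X : Type) (F : fieldType) (d : nat) (f : X -> 'rV[F]_d).
Implicit Types (nd : seq bool -> X) (lf : seq bool -> 'rV[F]_d).

(** Nodes are addressed by bit lists, so that passing to the subtree on side [b] is composition with
    [cons b]. *)
Fixpoint path_ok nd (a : 'rV[F]_d) (s : seq bool) : bool :=
  if s is b :: s' then
    ((dotp a (f (nd [::])) == 0) == b) && path_ok (nd \o cons b) a s'
  else true.

Lemma path_okP nd a s :
  path_ok nd a s <->
  forall k, (k < size s)%N ->
    (dotp a (f (nd (take k s))) == 0) = nth false s k.
Proof.
elim: s nd => [|b s IH] nd //=; split.
  by case/andP=> /eqP bE /IH sE [|k] //= /sE.
move=> sE; rewrite (sE 0%N) // eqxx; apply/IH => k ks.
exact: (sE k.+1).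
Qed.

(** [P] accumulates the conditions imposed by the nodes already passed, so each subtree is counted
    on its own. *)
Fixpoint count_ok n nd lf (P : pred 'rV[F]_d) : nat :=
  if n is n'.+1 then
    (count_ok n' (nd \o cons false) (lf \o cons false)
       [pred a | P a && (dotp a (f (nd [::])) != 0)%R] +
     count_ok n' (nd \o cons true) (lf \o cons true)
       [pred a | P a && (dotp a (f (nd [::])) == 0)%R])%N
  else P (lf [::]).

Lemma sub_count_ok n nd lf (P Q : pred 'rV[F]_d) :
  subpred P Q -> (count_ok n nd lf P <= count_ok n nd lf Q)%N.
Proof.
elim: n nd lf P Q => [|n IH] nd lf P Q sPQ /=.
  by have := sPQ (lf [::]); case: (P _) => // ->.
by apply: leq_add; apply: IH => a /= /andP[/sPQ-> ->].
Qed.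

Lemma count_ok0 n nd lf (P : pred 'rV[F]_d) :
  (forall a, ~~ P a) -> count_ok n nd lf P = 0%N.
Proof.
elim: n nd lf P => [|n IH] nd lf P P0 /=; first by rewrite (negPf (P0 _)).
by rewrite !IH // => a /=; rewrite (negPf (P0 a)).
Qed.

Lemma count_ok_sum n nd lf (P : pred 'rV[F]_d) :
  count_ok n nd lf P =
  (\sum_(s : n.-tuple bool) (P (lf s) && path_ok nd (lf s) s))%N.
Proof.
elim: n nd lf P => [|n IH] nd lf P.
  rewrite (big_pred1 [tuple]) /= ?andbT // => t.
  by rewrite [t]tuple0 /= eqxx.
pose h (p : bool * n.-tuple bool) := [tuple of p.1 :: p.2].
pose h' (t : n.+1.-tuple bool) := (thead t, [tuple of behead t]).
have hK : cancel h h'.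
  by case=> b t; rewrite /h/h' theadE; congr pair; apply: val_inj.
have hK' : cancel h' h by move=> t; rewrite /h /= -tuple_eta.
rewrite (reindex h) /=; last by apply: onW_bij; exists h'.
rewrite -(pair_bigA _ (fun b (t : n.-tuple bool) =>
  nat_of_bool (P (lf (b :: t)) && path_ok nd (lf (b :: t)) (b :: t)))) /=.
rewrite big_bool /= !IH addnC.
congr addn; apply: eq_bigr => t _ /=; first by rewrite eqb_id andbA.
by rewrite eqbF_neg andbA.
Qed.

Lemma count_ok_upper n nd lf (P : pred 'rV[F]_d) (V : 'M[F]_d) :
    (forall a, P a -> a != 0) -> (forall a, P a -> (a <= V)%MS) ->
  (count_ok n nd lf P <= binom_lt n (\rank V))%N.
Proof.
elim: n nd lf P V => [|n IH] nd lf P V P0 PV /=.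
  case Pl: (P _) => //; apply: binom_lt_gt0; rewrite lt0n mxrank_eq0.
  by apply: contraNneq (P0 _ Pl) => V0; have := PV _ Pl; rewrite V0 submx0.
set x := f _.
have right_le : (count_ok n (nd \o cons true) (lf \o cons true)
    [pred a | P a && (dotp a x == 0)%R] <= binom_lt n (\rank (orth_in V x)))%N.
  apply: IH => a /= /andP[Pa ax]; first exact: P0.
  by rewrite sub_orth_in PV.
have left_le : (count_ok n (nd \o cons false) (lf \o cons false)
    [pred a | P a && (dotp a x != 0)%R] <= binom_lt n (\rank V))%N.
  by apply: IH => a /= /andP[Pa _]; [exact: P0 | exact: PV].
have [Vx|Vx] := eqVneq (V *m x^T) 0; last first.
  move: left_le; rewrite (rank_orth_in V x) Vx add1n binom_ltS => left_le.
  exact: leq_add.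
have rE := rank_orth_in V x; rewrite Vx eqxx add0n in rE.
(* Here V is contained in x^\perp: the 0-side is empty, and the 1-side keeps the dimension but has
   smaller depth. *)
rewrite count_ok0 ?add0n ?(leq_trans right_le) -?rE ?binom_lt_monol // => a /=.
apply/negP => /andP[/PV aV /(sub_dotp_neq0 aV)].
by rewrite Vx eqxx.
Qed.

Hypothesis f_generic : forall s : seq 'rV[F]_d, all (fun w => w != 0) s ->
  exists x, all (fun w => dotp w (f x) != 0) s.
Hypothesis F_infinite : forall s : seq F, exists c, c \notin s.

(** It is enough to avoid w^\perp for one nonzero w in each V. *)
Lemma generic_mul_neq0 (Vs : seq 'M[F]_d) : (forall V, V \in Vs -> V != 0) ->
  exists x, forall V, V \in Vs -> V *m (f x)^T != 0.
Proof.
move=> Vs0; have [|x] := @f_generic (map (@nz_row _ _ _) Vs).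
  by apply/allP => _ /mapP[V VVs ->]; rewrite nz_row_eq0 Vs0.
move=> /allP xE; exists x => V VVs.
by apply: sub_dotp_neq0 (nz_row_sub V) (xE _ (map_f _ VVs)).
Qed.

Lemma count_ok_lower n (V : 'M[F]_d) (bs : seq 'rV[F]_d) :
    V != 0 -> (forall b, b \in bs -> V *m b^T != 0) ->
  exists nd lf, (forall u, lf u != 0) /\
    (binom_lt n (\rank V) <= count_ok n nd lf
      [pred a | [&& (a != 0)%R, (a <= V)%MS & all (fun b => dotp a b != 0)%R bs]])%N.
Proof.
elim: n V bs => [|n IH] V bs V0 Vbs.
  have [x _] := @generic_mul_neq0 [::] (fun V => ltac:(by [])).
  have [a [a0 aV abs]] := exists_avoiding F_infinite V0 Vbs.
  exists (fun=> x), (fun=> a); split=> //=; rewrite a0 aV.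
  have -> /= : all (fun b => dotp a b != 0) bs by apply/allP.
  rewrite /binom_lt; case: (\rank V) => [|r]; first by rewrite big_ord0.
  by rewrite big_ord_recl big1 // => i _; rewrite bin0n.
have orthV0 b : V *m b^T != 0 -> (1 < \rank V)%N -> orth_in V b != 0.
  by move=> Vb; rewrite (rank_orth_in V b) Vb -mxrank_eq0 -lt0n.
have [x [Vx xbs]] : exists x, V *m (f x)^T != 0 /\
    ((1 < \rank V)%N -> forall b, b \in bs -> orth_in V b *m (f x)^T != 0).
  case: (ltnP 1 (\rank V)) => [rV|_]; last first.
    have [|x xE] := @generic_mul_neq0 [:: V]; first by move=> W /[!inE]/eqP->.
    by exists x; split=> //; exact: xE (mem_head _ _).
  have [|x xE] := @generic_mul_neq0 (V :: map (orth_in V) bs).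
    move=> W /[!inE]/predU1P[->//|/mapP[b bbs ->]].
    by apply: orthV0 => //; exact: Vbs.
  exists x; split=> [|_ b bbs]; first exact: xE (mem_head _ _).
  by apply: xE; rewrite inE map_f ?orbT.
have [|nd0 [lf0 [lf0_neq0 le0]]] := IH V (f x :: bs) V0.
  by move=> b /[!inE]/predU1P[->//|]; exact: Vbs.
have [nd1 [lf1 [lf1_neq0 le1]]] : exists nd lf, (forall u, lf u != 0) /\
    (binom_lt n (\rank (orth_in V (f x))) <= count_ok n nd lf
      [pred a | [&& (a != 0)%R, (a <= orth_in V (f x))%MS &
                    all (fun b => dotp a b != 0)%R bs]])%N.
  case: (ltnP 1 (\rank V)) => rV.
    apply: IH => [|b bbs]; first exact: orthV0.
    by apply: orth_in_swap => //; [exact: Vbs | exact: xbs].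
  (* If V is a line, the 1-side must contribute 0, so any labeling will do. *)
  exists nd0, lf0; split=> //; move: rV; rewrite (rank_orth_in V (f x)) Vx.
  by rewrite add1n ltnS leqn0 => /eqP->; rewrite /binom_lt big_ord0.
exists (fun u => if u is b :: u' then (if b then nd1 else nd0) u' else x).
(* The value at the empty list is never counted; [lf0 u] only keeps it nonzero. *)
exists (fun u => if u is b :: u' then (if b then lf1 else lf0) u' else lf0 u).
split; first by move=> [|[] u].
rewrite (rank_orth_in V (f x)) Vx add1n binom_ltS.
rewrite (rank_orth_in V (f x)) Vx add1n in le0.
apply: leq_add; [apply: leq_trans le0 _ | apply: leq_trans le1 _];
  apply: sub_count_ok => a /=.
  by case/and4P=> -> -> -> ->.
by rewrite sub_orth_in => /and3P[-> /andP[-> ->] ->].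
Qed.

(** * From bit lists to labeled trees *)

Definition bits n (t : {ffun 'I_n -> bool}) : seq bool :=
  [seq t i | i <- enum 'I_n].

Lemma size_bits n (t : {ffun 'I_n -> bool}) : size (bits t) = n.
Proof. by rewrite size_map size_enum_ord. Qed.

Lemma nth_bits n (t : {ffun 'I_n -> bool}) (i : 'I_n) :
  nth false (bits t) i = t i.
Proof. by rewrite (nth_map i) ?size_enum_ord // nth_ord_enum. Qed.

Lemma bits_restr n (t : {ffun 'I_n -> bool}) (k : 'I_n) :
  bits (restr t k) = take k (bits t).
Proof.
have sz : size (bits (restr t k)) = size (take k (bits t)).
  by rewrite size_takel ?size_bits // ltnW.
apply: (@eq_from_nth _ false) => // i; rewrite size_bits => ik.
rewrite nth_take // (nth_bits _ (Ordinal ik)) ffunE.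
by rewrite -nth_bits.
Qed.

Definition realizes n (T : ltree (zero_sets f) n) nd lf :=
  (forall k t, @node _ _ _ T k t = nd (bits t)) /\
  (forall t, leaf T t = zero_set f (lf (bits t))).

Lemma num_well_labeled_count n (T : ltree (zero_sets f) n) nd lf
    (P : pred 'rV[F]_d) :
  realizes T nd lf -> (forall u, P (lf u)) ->
  num_well_labeled T = count_ok n nd lf P.
Proof.
move=> [ndE lfE] Plf; rewrite count_ok_sum /num_well_labeled -sum1_card.
pose h (t : n.-tuple bool) := [ffun i => tnth t i].
pose h' (t : {ffun 'I_n -> bool}) := [tuple t i | i < n].
have hb (t : n.-tuple bool) : bits (h t) = t.
  apply: (@eq_from_nth _ false) => [|i]; rewrite size_bits ?size_tuple // => i_n.
  by rewrite (nth_bits _ (Ordinal i_n)) ffunE (tnth_nth false).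
rewrite (reindex h) /=; last first.
  apply: onW_bij; exists h' => [t|t].
    by apply: eq_from_tnth => i; rewrite tnth_mktuple ffunE.
  by apply/ffunP => i; rewrite ffunE tnth_mktuple.
rewrite [LHS]big_mkcond /=; apply: eq_bigr => t _; rewrite Plf /=.
suff -> : h t \in [pred t | `[< well_labeled T t >]] = path_ok nd (lf t) t.
  by case: path_ok.
rewrite inE; apply/asboolP/idP => [wl|/path_okP pE k].
  apply/path_okP => k; rewrite size_tuple => k_n.
  have := wl (Ordinal k_n); rewrite lfE ndE bits_restr hb /= /zero_set /=.
  rewrite ffunE (tnth_nth false) /= => wlk.
  by apply/eqP/idP => /wlk.
rewrite lfE ndE bits_restr hb ffunE (tnth_nth false) -pE ?size_tuple //.
by split=> [/eqP|/eqP].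
Qed.

Lemma rho_zero_sets n : rho (zero_sets f) n = binom_lt n d.
Proof.
apply/eqP; rewrite eqn_leq; apply/andP; split.
  apply/bigmax_leqP => k /asboolP[T <-].
  have [x0 _] := @generic_mul_neq0 [::] (fun V => ltac:(by [])).
  pose ff m s := [ffun i : 'I_m => nth false s i].
  have ffK m (t : {ffun 'I_m -> bool}) : ff m (bits t) = t.
    by apply/ffunP => i; rewrite ffunE nth_bits.
  (* [x0] is a default for lists too long to be inner nodes; [lf] chooses a normal vector of each
     leaf label. *)
  pose nd s := if insub (size s) is Some k then @node _ _ _ T k (ff k s) else x0.
  pose lf s := s2val (cid2 (leaf_in T (ff n s))).
  have lf0 s : lf s != 0 by rewrite /lf; case: cid2.
  rewrite (@num_well_labeled_count _ _ nd lf (fun a => a != 0)) //.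
    rewrite -[d in binom_lt n d](mxrank1 F d).
    by apply: count_ok_upper => // a _; exact: submx1.
  split=> [j t|t]; rewrite /nd /lf.
    case: insubP => [j' _|]; rewrite size_bits ?ltn_ord //.
    by move/val_inj => ->; rewrite ffK.
  by rewrite ffK; case: cid2.
(* For d = 0 the full space is zero, and [count_ok_lower] does not apply. *)
case: (posnP d) => [d0|d_gt0].
  by apply: leq_trans (leq0n _); rewrite d0 /binom_lt big_ord0.
have V0 : (1%:M : 'M[F]_d) != 0 by rewrite -mxrank_eq0 mxrank1 -lt0n.
have [nd [lf [lf0 le]]] := @count_ok_lower n 1%:M [::] V0 (fun b => ltac:(by [])).
pose T := @LTree X (zero_sets f) n (fun k t => nd (bits t))
  (fun t => zero_set f (lf (bits t)))
  (fun t => ex_intro2 _ _ (lf (bits t)) (lf0 _) erefl).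
rewrite mxrank1 in le; apply: leq_trans le _.
apply: leq_trans (sub_count_ok _ _ _ (Q := fun a => a != 0) _) _.
  by move=> a /andP[].
rewrite -(@num_well_labeled_count _ T) //.
have numT : (num_well_labeled T < (2 ^ n).+1)%N.
  by rewrite ltnS (leq_trans (max_card _)) // card_ffun card_bool card_ord.
apply: (@leq_bigmax_cond _ _ _ (Ordinal numT)).
by apply/asboolP; exists T.
Qed.

End Count.

(** * Consequences of not being covered by finitely many proper subspaces *)

Section Generic.
Variables (X : Type) (F : fieldType) (d : nat) (f : X -> 'rV[F]_d).
Hypothesis hf : ~ exists s : seq {vspace 'rV[F]_d},
  (forall V, V \in s -> V != fullv) /\
  (forall x : X, exists2 V, V \in s & f x \in V).

Lemma not_covered_generic (s : seq 'rV[F]_d) : all (fun w => w != 0) s ->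
  exists x, all (fun w => dotp w (f x) != 0) s.
Proof.
move=> /allP s0; apply: contrapT => /forallNP noX; apply: hf.
pose orth (w : 'rV[F]_d) : {vspace 'rV[F]_d} := lker (linfun (mulmxr w^T)).
have orthE w y : (y \in orth w) = (dotp w y == 0).
  rewrite memv_ker lfunE /= -dotp_eq0 /dotp; congr (_ == 0).
  by apply: eq_bigr => i _; rewrite mulrC.
exists (map orth s); split=> [_ /mapP[w ws ->]|x].
  (* If w^\perp were everything, testing it on the standard basis would give w = 0. *)
  apply: contraNneq (s0 _ ws) => /vspaceP orthw; apply/eqP/rowP => i.
  have /eqP := orthw (delta_mx 0 i); rewrite orthE memvf eqb_id.
  rewrite /dotp (bigD1 i) //= big1 => [|j ji]; rewrite !mxE ?eqxx /=.
    by rewrite mulr1 addr0 => /eqP.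
  by rewrite (negPf ji) mulr0.
have /negP/allPn[w ws /negPn wx] := noX x.
by exists (orth w); [exact: map_f | rewrite orthE].
Qed.

(* Otherwise the hyperplanes y_1 = 0 and y_0 = c y_1, c in F, would be a      *)
(* finite cover of F^d.                                                       *)
Lemma not_covered_infinite :
  (2 <= d)%N -> forall s : seq F, exists c, c \notin s.
Proof.
move=> d2 s; apply: contrapT => /forallNP sF.
have d1 : (1 < d)%N by []. have d0 : (0 < d)%N by exact: ltnW.
pose i0 : 'I_d := Ordinal d0; pose i1 : 'I_d := Ordinal d1.
pose w c : 'rV[F]_d := delta_mx 0 i0 - c *: delta_mx 0 i1.
have dotp_delta i y : dotp (delta_mx 0 i) y = y 0 i.
  rewrite /dotp (bigD1 i) //= big1 => [|j ji]; rewrite !mxE ?eqxx /=.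
    by rewrite mul1r addr0.
  by rewrite (negPf ji) mul0r.
have [|x] := @not_covered_generic (delta_mx 0 i1 :: map w s).
  apply/andP; split.
    by apply/eqP => /rowP/(_ i1)/eqP; rewrite !mxE !eqxx oner_eq0.
  apply/allP => _ /mapP[c _ ->].
  apply/eqP => /rowP/(_ i0)/eqP.
  by rewrite !mxE !eqxx /= mulr0 subr0 oner_eq0.
rewrite /= dotp_delta => /andP[x1 /allP/(_ (w (f x 0 i0 / f x 0 i1)))].
have /negP/negPn cs := sF (f x 0 i0 / f x 0 i1).
rewrite map_f // => /(_ isT); rewrite /w -scaleNr dotpDl dotpZl !dotp_delta.
by rewrite mulNr divfK // subrr eqxx.
Qed.

End Generic.

(** * Growth of binomial sums and the density *)

Section Growth.
Variable (R : realType).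

Lemma ffact_le_exp n k : (n ^_ k <= n ^ k)%N.
Proof.
by elim: k => [|k IH]; rewrite ?ffactnSr ?expnSr ?leq_mul ?leq_subr.
Qed.

Lemma binom_lt_le_exp n m : (1 <= n)%N -> (binom_lt n m.+1 <= m.+1 * n ^ m)%N.
Proof.
move=> n1; rewrite -[m.+1 in leqRHS]card_ord -sum_nat_const.
apply: leq_sum => i _; apply: (@leq_trans (n ^ i)%N).
  apply: leq_trans (ffact_le_exp n i).
  by rewrite -bin_ffact leq_pmulr // fact_gt0.
by rewrite leq_pexp2l // -ltnS.
Qed.

(** For n >= 2m each factor n - k of the falling factorial is at least n/2. *)
Lemma exp_le_binom_lt n m : (2 * m <= n)%N ->
  (n ^ m <= 2 ^ m * m`! * binom_lt n m.+1)%N.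
Proof.
move=> mn; apply: (@leq_trans (2 ^ m * n ^_ m)%N); last first.
  rewrite -mulnA leq_mul2l -bin_ffact mulnC leq_mul2l.
  by rewrite /binom_lt big_ord_recr /= leq_addl !orbT.
have H k : (k <= m)%N -> (n ^ k <= 2 ^ k * n ^_ k)%N.
  elim: k => [|k IH] // km; rewrite ffactnSr !expnS.
  have := IH (ltnW km); have : (n <= 2 * (n - k))%N by lia.
  move=> h1 h2; have := leq_mul h1 h2; lia.
exact: H.
Qed.

(** If l < m, dividing the lower bound n^m / (2^m m!) by n^l would make n^(m-l) bounded for n >=
    2m. *)
Lemma growth_exponent_ge (r : nat -> nat) m (l K : R) : (0 < m)%N ->
    (forall n, (m <= n)%N -> r n = binom_lt n m.+1) ->
    (forall n, (1 <= n)%N -> (r n)%:R <= K * n%:R `^ l) ->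
  m%:R <= l.
Proof.
move=> m0 rE rK; rewrite leNgt; apply/negP => lm.
pose e := m%:R - l; have e0 : 0 < e by rewrite subr_gt0.
pose B : R := (2 ^ m * m`!)%:R * K.
have H n : (2 * m <= n)%N -> n%:R `^ e <= B.
  move=> mn; have n1 : (1 <= n)%N by lia.
  have n0 : (0 : R) < n%:R by rewrite ltr0n.
  rewrite -(ler_pM2r (powR_gt0 l n0)) -powRD; last by rewrite (gt_eqF n0) implybT.
  rewrite subrK powR_mulrn ?ler0n // -mulrA.
  have := exp_le_binom_lt mn; rewrite -(ler_nat R) natrM natrX => /le_trans; apply.
  by rewrite ler_wpM2l ?ler0n // -rE ?rK //; lia.
(* Chosen so that y^e = |B| + 1 > B; an integer that is at least y and at least 2m then contradicts
   [H]. *)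
pose y := (`|B| + 1) `^ e^-1.
have := archi_boundP (powR_ge0 (`|B| + 1) e^-1); rewrite -/y.
set N := Num.bound _ => yN.
have := H (N + 2 * m)%N (leq_addl _ _); apply/negP; rewrite -ltNge.
have : y `^ e = `|B| + 1.
  by rewrite -powRrM mulVf ?(gt_eqF e0) // powRr1 // addr_ge0.
move=> yE; apply: (@lt_le_trans _ _ (`|B| + 1)).
  by rewrite (le_lt_trans (ler_norm _)) // ltrDl.
rewrite -yE ge0_ler_powR ?nnegrE ?powR_ge0 ?ler0n ?(ltW e0) //.
by rewrite natrD (le_trans (ltW yN)) // lerDl.
Qed.

Lemma Lden_eq (X : Type) (C : set (set X)) m : (0 < m)%N ->
  (forall n, rho C n = binom_lt n m.+1) -> Lden C R = (m%:R)%:E.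
Proof.
move=> m0 rE; apply/eqP; rewrite eq_le; apply/andP; split.
  apply: ereal_inf_lbound; exists m%:R => //; split; first by rewrite ltr0n.
  exists m.+1%:R => n n1; rewrite powR_mulrn ?ler0n // -natrX -natrM ler_nat rE.
  exact: binom_lt_le_exp.
apply: le_ereal_inf_tmp => _ [l [l0 [K rK]] <-]; rewrite lee_fin.
by apply: growth_exponent_ge m0 _ rK => n _; exact: rE.
Qed.

End Growth.

Theorem corollary4p5 (R : realType) (X : Type) (F : fieldType) (d : nat)
    (hd : (2 <= d)%N) (f : X -> 'rV[F]_d)
    (hf : ~ exists s : seq {vspace 'rV[F]_d},
        (forall V, V \in s -> V != fullv) /\
        (forall x : X, exists2 V, V \in s & f x \in V)) :
  maximal_Ldim (zero_sets f) d.-1 /\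
  Lden (zero_sets f) R = (d.-1%:R)%:E.
Proof.
have rE n : rho (zero_sets f) n = binom_lt n d.-1.+1.
  rewrite prednK ?(ltnW hd) //; apply: rho_zero_sets.
    exact: not_covered_generic.
  exact: not_covered_infinite hf hd.
split=> [n _|]; first exact: rE.
by apply: Lden_eq rE; lia.
Qed.
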